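(* Let $M\in\mathbb{N}$ and assume that each player $x\in\Lambda_M:=[-M,M]\times[-M,M]\subset\mathbb{Z}^2$ adopts the strategy $\pi_x$ described in the context. Then there exists an almost surely finite random time $T_M$ after which no agent $x\in\Lambda_M$ can gain by any change of his strategy, given the strategies currently pursued by the other players. That is, almost surely, for every $x\in\Lambda_M$ and every change, from time $T_M$ on, of the decisions of $x$ (the other players keeping their strategies), there is no decision time $t_{x,n}>T_M$ at which $x$ does not lose under the changed strategy while he loses under $\pi_x$.
   Context: **Model.** $\mathbb{Z}^2$ carries the distance $d(x,y)=|x_1-y_1|+|x_2-y_2|$; for a site $x$ and $r\in\mathbb{N}$ let $B_r(x)=\{z\in\mathbb{Z}^2:d(x,z)\le r\}$. The configuration space is $S=\{-1,+1\}^{\mathbb{Z}^2}$; $\eta_\Lambda$ is the restriction of $\eta\in S$ to $\Lambda$. $\mathcal{G}=(V,E)$ is a random graph with $V=\mathbb{Z}^2$ such that, with probability one, every pair $x,y$ with $d(x,y)=1$ is joined by an edge, and $\mathbb{P}(|\{y:\{x,y\}\in E\}|<\infty)=1$ for all $x\in V$. A function $j:V\times V\to\{-1,0,+1\}$ is given with $j(x,y)=0$ if $\{x,y\}\notin E$ and $j(x,y)\in\{-1,+1\}$ otherwise; $j$ need not be symmetric. A process $\sigma:[0,\infty)\to S$ evolves as follows. $\sigma_0$ has the symmetric Bernoulli product law. Each site $x$ has an independent rate-1 Poisson process with arrival times (decision times of player $x$) $t_{x,1}<t_{x,2}<\dots$. The value $\sigma_t(x)$ changes only at these times, by $\sigma_{t_{x,n}}(x)=u_{x,n}$,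 where $u_{x,n}\in\{-1,+1\}$ is the decision of $x$; a strategy of $x$ is a sequence $(u_{x,1},u_{x,2},\dots)$. At each decision time $t=t_{x,n}$, player $x$ receives (and observes) the reward $$h_t(x)=\operatorname{sgn}\Big(\sum_{y:\{x,y\}\in E} j(x,y)\sigma_t(x)\sigma_t(y)\Big)\in\{-1,0,+1\},\qquad \operatorname{sgn}(0)=0 .$$ Players know neither $E$ nor $j$. Each player only distinguishes between ''losing'' ($h_t(x)<0$) and ''not losing'' ($h_t(x)\ge0$) at his decision times. **The strategy $\pi_x$.** Write $t_n,u_n,h_n$ for $t_{x,n},u_{x,n},h_{t_{x,n}}(x)$. Player $x$ maintains a collection $\mathcal{R}$ (initially empty) of triples $(\eta,u,h)$, where $\eta$ is a configuration on a finite ball $B_r(x)$, $u\in\{-1,+1\}$, $h\in\{-1,0,+1\}$. Recorded configurations are those seen immediately before the update, i.e. at time $t_n-$. - At time $t_1$: $u_1=\pm1$ is chosen by a fair coin toss, and $(\sigma_{B_1(x)},u_1,h_1)$ is added to $\mathcal{R}$. - At time $t_{n+1}$: let $B_{r_n}(x)$ be the support of the last configuration added to $\mathcal{R}$, and let $\sigma'=\sigma_{B_{r_n}(x)}(t_{n+1}-)$. (a) If there exists $(\sigma',u',h')\in\mathcal{R}$, set $u_{n+1}=u'\,\frac{h'}{|h'|}$, with the convention $0/|0|:=1$. If the resulting reward satisfies $h_{n+1}\ge 0$, nothing else is done; if $h_{n+1}<0$, add $(\sigma_{B_{r_n+1}(x)},u_{n+1},h_{n+1})$ to $\mathcal{R}$.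 (b) Otherwise set $u_{n+1}=u_n$ and add $(\sigma',u_{n+1},h_{n+1})$ to $\mathcal{R}$. *)

(* Defs.v *)
From HB Require Import structures.
From mathcomp Require Import all_boot all_order all_algebra finmap.
From mathcomp Require Import all_classical all_reals all_analysis.
From mathcomp Require Import measurable_realfun.

Set Implicit Arguments.
Unset Strict Implicit.
Unset Printing Implicit Defensive.

Import Order.TTheory GRing.Theory Num.Theory.
Import numFieldNormedType.Exports.

Local Open Scope classical_set_scope.
Local Open Scope ring_scope.

Definition site : Type := (int * int)%type.

Definition dist (x y : site) : nat := (`|x.1 - y.1| + `|x.2 - y.2|)%N.

Definition box (M : nat) : set site :=
  [set x | - (M%:Z) <= x.1 <= M%:Z /\ - (M%:Z) <= x.2 <= M%:Z].

(* [true] stands for the spin +1 and [false] for the spin -1. *)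
Definition spin : Type := bool.
Definition spin_val (u : spin) : int := if u then 1 else -1.

Definition config : Type := site -> spin.

(* The sum is a [fsbig] sum: it has its usual meaning as soon as the degree
   of x is finite. *)
Definition reward (E : rel site) (j : site -> site -> int) (eta : config)
    (x : site) : int :=
  Num.sg (\sum_(y \in [set y | E x y])
            (j x y * spin_val (eta x) * spin_val (eta y))).

(* A configuration on B_r(x) is a partial configuration whose domain is exactly
   B_r(x), so that configurations on different balls are different. *)
Definition local_config : Type := site -> option spin.
Definition restr (r : nat) (x : site) (eta : config) : local_config :=
  fun z => if (dist x z <= r)%N then Some (eta z) else None.

Section Dynamics.
Variable R : realType.

(* [p s] is the configuration at time s; only the times s >= 0 matter. *)
Definition trajectory : Type := R -> config.

(* The configuration at time s-, for the discrete topology on spins. *)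
Definition before (p : trajectory) (s : R) : config :=
  fun y => lim (p r y @[r --> s^'-]).

(* In [s tm h p n], the player has decision times [tm], receives the reward
   [h k] at time [tm k], and sees the trajectory [p]; the value is his decision
   at time [tm n].  Indices start at 0: [tm n] is the (n+1)-st decision time. *)
Definition strategy : Type :=
  (nat -> R) -> (nat -> int) -> trajectory -> nat -> spin.

Definition nonanticipating (s : strategy) : Prop :=
  forall (tm tm' : nat -> R) (h h' : nat -> int) (p p' : trajectory) (n : nat),
    (forall k, (k <= n)%N -> tm k = tm' k) ->
    (forall k, (k < n)%N -> h k = h' k) ->
    (forall r : R, 0 <= r -> r < tm n -> p r = p' r) ->
    s tm h p n = s tm' h' p' n.

Record memory := Memory {
  records : seq (local_config * spin * int);
  radius : nat;     (* of the ball of the last recorded configuration *)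
  decision : spin   (* the last decision *)
}.

(* The first triple of [l] with configuration [eta]; the records produced by
   [pi_memory] have at most one such triple. *)
Definition recall (l : seq (local_config * spin * int)) (eta : local_config) :
    option (spin * int) :=
  ohead [seq (e.1.2, e.2) | e <- l & e.1.1 == eta].

(* u * h / |h|, with 0 / |0| = 1. *)
Definition correct (u : spin) (h : int) : spin := if h < 0 then ~~ u else u.

(* One decision, when the configuration just before is [eta] and the reward
   for the new decision turns out to be [h]. *)
Definition pi_step (x : site) (eta : config) (h : int) (m : memory) : memory :=
  let eta' := restr (radius m) x eta in
  match recall (records m) eta' with
  | Some (u', h') =>
      let u := correct u' h' in
      if 0 <= h then Memory (records m) (radius m) u
      else Memory ((restr (radius m).+1 x eta, u, h) :: records m)
                  (radius m).+1 u
  | None =>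
      let u := decision m in
      Memory ((eta', u, h) :: records m) (radius m) u
  end.

(* The memory of the player at x right after his decision at time [tm n];
   [c] is the coin toss for the first decision. *)
Fixpoint pi_memory (x : site) (c : spin) (tm : nat -> R) (h : nat -> int)
    (p : trajectory) (n : nat) : memory :=
  match n with
  | 0%N => Memory [:: (restr 1 x (before p (tm 0%N)), c, h 0%N)] 1 c
  | n'.+1 =>
      pi_step x (before p (tm n'.+1)) (h n'.+1) (pi_memory x c tm h p n')
  end.

Definition pi_strategy (x : site) (c : spin) : strategy :=
  fun tm h p n => decision (pi_memory x c tm h p n).

Section Path.
Variables (E : rel site) (j : site -> site -> int) (tm : site -> nat -> R).

(* The decisions made along [p] by players using the strategies [s]. *)
Definition decisions (s : site -> strategy) (p : trajectory) (x : site) :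
    nat -> spin :=
  s x (tm x) (fun k => reward E j (p (tm x k)) x) p.

(* [p] moves only at decision times, according to the decisions [u]. *)
Definition evolves (u : site -> nat -> spin) (p : trajectory) : Prop :=
  (forall x n, p (tm x n) x = u x n) /\
  (forall x (r r' : R), 0 <= r -> r <= r' ->
     (forall n, ~ (r < tm x n <= r')) -> p r' x = p r x).

(* [p'] results from [p] when, from time [T] on, the player at x takes
   arbitrary decisions [v] and the other players go on with their strategies
   (and so react to the new trajectory). *)
Definition deviation (s : site -> strategy) (p : trajectory) (x : site)
    (T : \bar R) (p' : trajectory) : Prop :=
  exists v : nat -> spin,
    [/\ p' 0 = p 0,
        (forall r : R, 0 <= r -> (r%:E < T)%E -> p' r = p r) &
        evolves (fun y => if y == x then v else decisions s p' y) p'].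

End Path.
End Dynamics.

Section Randomness.
Context {R : realType} {d : measure_display} {Omega : measurableType d}.
Variable P : probability Omega R.

Definition random_graph (E : Omega -> rel site) : Prop :=
  [/\ (forall x y, measurable [set w | E w x y]),
      (forall w, symmetric (E w) /\ irreflexive (E w)),
      {ae P, forall w, forall x y, dist x y = 1%N -> E w x y} &
      forall x, {ae P, forall w, finite_set [set y | E w x y]}].

Definition couplings (E : Omega -> rel site) (j : Omega -> site -> site -> int) :
    Prop :=
  [/\ (forall x y (k : int), measurable [set w | j w x y = k]),
      (forall w x y, ~~ E w x y -> j w x y = 0) &
      (forall w x y, E w x y -> j w x y = 1 \/ j w x y = -1)].

Definition symmetric_bernoulli (X : Omega -> config) : Prop :=
  (forall x, measurable [set w | X w x]) /\
  forall (J : {fset site}) (a : config),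
    P [set w | forall x, x \in J -> X w x = a x] = ((2^-1 ^+ #|` J|)%:E)%E.

Definition mutually_independent (I : choiceType) (F : I -> set (set Omega)) :
    Prop :=
  forall (J : {fset I}) (A : I -> set Omega),
    (forall i, i \in J -> F i (A i)) ->
    P (\bigcap_(i in [set` J]) A i) = (\prod_(i <- J) P (A i))%E.

Definition gap (tm : Omega -> site -> nat -> R) (x : site) (n : nat)
    (w : Omega) : R :=
  tm w x n - (if n is n'.+1 then tm w x n' else 0).

(* Arrival times of rate-1 Poisson processes, by their i.i.d. gaps; the
   independence of the gaps is part of [independent_sources]. *)
Definition poisson_times (tm : Omega -> site -> nat -> R) : Prop :=
  (forall x n, measurable_fun setT (fun w => tm w x n)) /\
  forall x n (A : set R), measurable A ->
    P (gap tm x n @^-1` A) = exponential_prob 1 A.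

Definition fair_coins (c : Omega -> site -> spin) : Prop :=
  forall x, measurable [set w | c w x] /\ P [set w | c w x] = ((2^-1)%:E)%E.

(* The independent sources of randomness: the initial data (graph, couplings
   and initial configuration, taken together), each gap of each clock and
   each coin. *)
Definition source : Type := (unit + site * nat + site)%type.

Definition initial_events (E : Omega -> rel site)
    (j : Omega -> site -> site -> int) (X : Omega -> config) :
    set (set Omega) :=
  [set A | [\/ exists x y, A = [set w | E w x y],
               exists x y k, A = [set w | j w x y = k] |
               exists x, A = [set w | X w x]]].

Definition source_events (E : Omega -> rel site)
    (j : Omega -> site -> site -> int) (X : Omega -> config)
    (tm : Omega -> site -> nat -> R) (c : Omega -> site -> spin) (i : source) :
    set (set Omega) :=
  match i with
  | inl (inl _) => <<s initial_events E j X >>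
  | inl (inr (x, n)) => preimage_set_system setT (gap tm x n) measurable
  | inr x => <<s [set [set w | c w x]] >>
  end.

Definition independent_sources (E : Omega -> rel site)
    (j : Omega -> site -> site -> int) (X : Omega -> config)
    (tm : Omega -> site -> nat -> R) (c : Omega -> site -> spin) : Prop :=
  @mutually_independent source (source_events E j X tm c).

End Randomness.

(* Main.v *)
(* A player following pi_x loses only finitely often, so T_M can be taken to be
   the last time at which some player of the box loses.  Indeed every loss
   stores a record with a new configuration.  Once the radius of the
   configurations reaches a radius N such that B_N(x) contains the neighbours
   of x, a recalled record never leads to a loss, because the reward is then a
   function of the decision and of the recalled configuration, odd in the
   decision; hence the radius never exceeds N, and the recorded configurations
   range over a finite set.

   That the configuration seen before a decision determines the reward
   requires that, almost surely, decision times are locally finite and no two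
   players decide simultaneously. *)

Require Import Defs.
From HB Require Import structures.
From mathcomp Require Import all_boot all_order all_algebra finmap.
From mathcomp Require Import all_classical all_reals all_analysis.
From mathcomp Require Import measurable_realfun.
From mathcomp Require Import zify lra ring.

Set Implicit Arguments.
Unset Strict Implicit.
Unset Printing Implicit Defensive.

Import Order.TTheory GRing.Theory Num.Theory.
Import numFieldNormedType.Exports.

Local Open Scope classical_set_scope.
Local Open Scope ring_scope.

(** * The memory of a player *)

Lemma restr_inj_radius (r r' : nat) (x : site) (f g : config) :
  restr r x f = restr r' x g -> r = r'.
Proof.
wlog lt_rr' : r r' f g / (r < r')%N => [th e|].
  by have [/th/(_ e)|/th/(_ (esym e))|] := ltngtP r r'.
move=> /(congr1 (fun e => e (x.1 + r'%:Z, x.2))).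
rewrite /restr /dist /= subrr addn0 opprD addrA subrr sub0r abszN absz_nat.
by rewrite leqnn leqNgt lt_rr'.
Qed.

Lemma restr_eq_in (r : nat) (x : site) (f g : config) (z : site) :
  restr r x f = restr r x g -> (dist x z <= r)%N -> f z = g z.
Proof.
by move=> /(congr1 (fun e => e z)) + xz; rewrite /restr xz => -[].
Qed.

(** This lists the square circumscribed about [B_N(x)]; only the inclusion of the ball in it
    matters. *)
Definition ball_sites (N : nat) (x : site) : seq site :=
  undup [seq (x.1 + (a%:Z - N%:Z), x.2 + (b%:Z - N%:Z))
           | a <- iota 0 (N + N).+1, b <- iota 0 (N + N).+1].
Arguments ball_sites : simpl never.

Lemma mem_ball_sites (N : nat) (x z : site) :
  (dist x z <= N)%N -> z \in ball_sites N x.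
Proof.
case: x z => [x1 x2] [z1 z2]; rewrite /dist /= => dxz.
rewrite mem_undup; apply/allpairsP.
exists (`|(z1 - x1 + N%:Z)%R|%N, `|(z2 - x2 + N%:Z)%R|%N).
rewrite !mem_iota !add0n; split=> /=; try lia.
by congr pair; lia.
Qed.

(** Such a restriction is [None] off [B_N(x)], hence determined by its values on [ball_sites N x];
    the bound counts the maps from this list to [option bool]. *)
Lemma local_config_bound (N : nat) (x : site) : exists B : nat,
  forall l : seq local_config, uniq l ->
    (forall e, e \in l ->
       exists r f, (r <= N)%N /\ e = restr r x f) -> (size l <= B)%N.
Proof.
pose enc (e : local_config) := [ffun i : 'I_(size (ball_sites N x)) =>
  e (tnth (in_tuple (ball_sites N x)) i)].
exists #|{: {ffun 'I_(size (ball_sites N x)) -> option bool}}| => l ul lP.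
have enc_inj : {in l &, injective enc}.
  move=> e e' /lP[r [f [rN ->]]] /lP[r' [f' [r'N ->]]] ee'.
  apply/funext => z; have [zN|zN] := leqP (dist x z) N; last first.
    by rewrite /restr !ifN// -ltnNge ?(leq_ltn_trans rN zN)
      ?(leq_ltn_trans r'N zN).
  have zl := mem_ball_sites zN.
  have /tnthP[i ->] : z \in in_tuple (ball_sites N x) by [].
  by move/ffunP/(_ i): ee'; rewrite !ffunE.
rewrite -(size_map enc) -(card_uniqP _); last by rewrite map_inj_in_uniq.
exact: max_card.
Qed.

Lemma recall_Some l (k : local_config) u h :
  recall l k = Some (u, h) -> (k, u, h) \in l.
Proof.
rewrite /recall; elim: l => //= -[[k' u'] h'] l IH /=.
case: eqP => [-> /= [-> ->]|_ /IH kl]; first by rewrite mem_head.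
by rewrite inE kl orbT.
Qed.

Lemma recall_None l (k : local_config) :
  recall l k = None -> k \notin [seq e.1.1 | e <- l].
Proof.
rewrite /recall; elim: l => //= -[[k' u'] h'] l IH /=.
by rewrite inE negb_or eq_sym; case: eqP => //= _ /IH.
Qed.

Lemma bounded_nondecreasing_stops (s : nat -> nat) (B : nat) :
  (forall n, s n <= s n.+1)%N -> (forall n, s n <= B)%N ->
  exists K, forall n, (K <= n)%N -> s n.+1 = s n.
Proof.
move=> s_nd sB.
have exP : exists m, `[< exists n, s n = m >].
  by exists (s 0%N); apply/asboolP; exists 0%N.
have leB m : `[< exists n, s n = m >] -> (m <= B)%N by move=> /asboolP[n <-].
have [m /asboolP[K <-] smax] := ex_maxnP exP leB.
exists K => n Kn; have smon : {homo s : a b / (a <= b)%N}.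
  exact: homo_leq (@leqnn) (@leq_trans) s_nd.
have sK a : (K <= a)%N -> s a = s K.
  move=> Ka; apply/eqP; rewrite eqn_leq (smon _ _ Ka) andbT.
  by apply: smax; apply/asboolP; exists a.
by rewrite !sK// (leq_trans Kn).
Qed.

Section PiStrategy.
Context {R : realType} (x : site) (c : spin) (tm : nat -> R) (h : nat -> int)
  (p : trajectory R) (N : nat).

Let eta n := before p (tm n).
Let memo n := pi_memory x c tm h p n.
Let u n := decision (memo n).

(** The game enters only through [h_same] and [h_opp]. Every loss lengthens [records], whose length
    is nondecreasing and bounded. *)
Lemma pi_memory_losses_finite (N_gt0 : (0 < N)%N)
    (h_same : forall m n, restr N x (eta m) = restr N x (eta n) ->
       u m = u n -> h m = h n)
    (h_opp : forall m n, restr N x (eta m) = restr N x (eta n) ->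
       u m = ~~ u n -> h m = - h n) :
  exists K, forall n, (K <= n)%N -> 0 <= h n.
Proof.
have memS n : memo n.+1 = pi_step x (eta n.+1) (h n.+1) (memo n) by [].
(* Each recorded triple stems from an actual decision [m], so that [h_same] and [h_opp] apply to
   it. *)
have inv n : [/\ (Defs.radius (memo n) <= N)%N,
    uniq [seq e.1.1 | e <- records (memo n)] &
    forall e, e \in records (memo n) -> exists m r,
      [/\ (r <= Defs.radius (memo n))%N, e.1.1 = restr r x (eta m),
          e.1.2 = u m & e.2 = h m]].
  elim: n => [|n [rN un recn]].
    split=> // e; rewrite inE => /eqP ->; exists 0%N, 1%N; split=> //.
  have uSn : u n.+1 = decision (pi_step x (eta n.+1) (h n.+1) (memo n)) by [].
  rewrite memS; move: uSn; rewrite /pi_step.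
  case rec: recall => [[u' h']|]; last first.
    move=> uSn /=; split=> //.
      by rewrite (recall_None rec).
    move=> e; rewrite inE => /predU1P[->|/recn//].
    by exists n.+1, (Defs.radius (memo n)).
  case: ifP => // /negbT; rewrite -ltNge => h_lt0 uSn.
  have {rec} := recall_Some rec => /recn[m [r [/= rrad eqr u'E h'E]]].
  (* At radius [N] the recalled configuration agrees with the present one on [B_N(x)]. The corrected
     decision then earns [- h m] if [h m < 0] and [h m] otherwise, so it cannot lose. *)
  have radN : (Defs.radius (memo n) < N)%N.
    rewrite ltn_neqAle rN andbT; apply/eqP => radN.
    have rE := restr_inj_radius eqr; rewrite -rE radN in eqr.
    move: uSn h_lt0 => /=; rewrite /correct u'E h'E.
    case: ifPn => [hm uSn|hm uSn].
      rewrite (h_opp n.+1 m)// oppr_lt0 => hm0.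
      by have := lt_trans hm0 hm; rewrite ltxx.
    by rewrite (h_same n.+1 m)// (negbTE hm).
  split=> //=.
    (* The enlarged configuration is new because its radius exceeds all recorded ones. *)
    rewrite un andbT; apply/mapP => -[e /recn[m' [r' [r'rad -> _ _]]]].
    by move=> /restr_inj_radius rr'; move: r'rad; rewrite -rr' ltnn.
  move=> e; rewrite inE => /predU1P[->|/recn[m' [r' [r'rad ? ? ?]]]].
    by exists n.+1, (Defs.radius (memo n)).+1.
  by exists m', r'; split=> //; exact: ltnW.
have [B sizeB] := local_config_bound N x.
have [||K sK] := @bounded_nondecreasing_stops (fun n => size (records (memo n))) B.
- move=> n; rewrite memS /pi_step.
  by case: recall => [[u' h']|] //=; case: ifP.
- move=> n; have [rN un recn] := inv n.
  rewrite -(size_map (fun e => e.1.1)); apply: sizeB => // k /mapP[e + ->].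
  move=> /recn[m [r [rr -> _ _]]]; exists r, (eta m); split=> //.
  exact: leq_trans rr rN.
(* A loss at index [n.+1] shows as growth from [memo n] to [memo n.+1], hence the shift to
   [K.+1]. *)
exists K.+1 => -[//|n] Kn; rewrite leNgt; apply/negP => h_lt0.
have := sK n Kn; rewrite memS /pi_step.
case: recall => [[u' h']|] /=; last by move/eqP; rewrite gtn_eqF.
by rewrite leNgt h_lt0 /= => /eqP; rewrite gtn_eqF.
Qed.

End PiStrategy.

(** * Losses along a trajectory *)

Section Reward.
Variables (E : rel site) (j : site -> site -> int) (x : site).

(** Since [j x] vanishes off the edges, the sum over neighbours, which varies with the graph,
    becomes one over a fixed list; measurability will rest on this. *)
Lemma reward_ball (N : nat) (f : config)
    (j0 : forall y, ~~ E x y -> j x y = 0)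
    (EN : forall y, E x y -> (dist x y <= N)%N) :
  reward E j f x =
  Num.sg (\sum_(y <- ball_sites N x)
    j x y * spin_val (f x) * spin_val (f y)).
Proof.
rewrite /reward; congr Num.sg; rewrite [RHS](fsbig_seq _ _ (undup_uniq _)).
apply: fsbig_widen => [y /= /EN yN|y [/= _ /negP/j0 ->]]; last by rewrite !mul0r.
exact: mem_ball_sites.
Qed.

Lemma reward_same (f g : config) :
  (forall y, E x y -> f y = g y) -> f x = g x -> reward E j f x = reward E j g x.
Proof.
move=> fg fgx; rewrite /reward; congr Num.sg.
by apply: eq_fsbigr => y /set_mem /= xy; rewrite fgx fg.
Qed.

Lemma reward_opp (f g : config) : finite_set [set y | E x y] ->
  (forall y, E x y -> f y = g y) -> f x = ~~ g x ->
  reward E j f x = - reward E j g x.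
Proof.
move=> Efin fg fgx; rewrite /reward -sgrN; congr Num.sg.
rewrite !fsbig_finite//= -sumrN big_seq [RHS]big_seq; apply: eq_bigr => y.
rewrite in_fset_set// => /set_mem /= xy; rewrite fgx fg//.
by rewrite -mulNr -mulrN; congr (_ * _ * _); case: (g x).
Qed.

Lemma finite_degree_radius : finite_set [set y | E x y] ->
  exists2 N, (0 < N)%N & forall y, E x y -> (dist x y <= N)%N.
Proof.
move=> /finite_seqP[s sE]; exists (\max_(y <- s) dist x y).+1 => // y xy.
apply: leqW; apply: leq_bigmax_seq => //.
by have : [set` s] y by rewrite -sE.
Qed.

End Reward.

Section Trajectory.
Context {R : realType} (tm : site -> nat -> R).
Hypothesis tm_gt0 : forall y n, 0 < tm y n.
Hypothesis tm_infty : forall y (r : R),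
  exists K, forall n, (K <= n)%N -> r < tm y n.
Hypothesis tm_neq : forall x y n m, x != y -> tm x n <> tm y m.

(** All but finitely many decision times exceed [r + 1]; the others that differ from [r] are
    finitely many, so their distances to [r] have a positive lower bound. *)
Lemma times_isolated (y : site) (r : R) :
  exists2 e, 0 < e & forall n, tm y n <> r -> e <= `|tm y n - r|.
Proof.
have [K tmK] := tm_infty y (r + 1).
suff [e e_gt0 eK] : exists2 e, 0 < e &
    forall n, (n < K)%N -> tm y n <> r -> e <= `|tm y n - r|.
  exists (Num.min e 1) => [|n nr]; first by rewrite lt_min e_gt0 ltr01.
  rewrite ge_min; have [nK|Kn] := ltnP n K; first by rewrite eK.
  apply/orP; right; apply: le_trans (ler_norm _).
  by rewrite lerBrDl; apply/ltW/tmK.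
elim: {tmK} K => [|K [e e_gt0 eK]]; first by exists 1.
have [tmr|tmr] := eqVneq (tm y K) r.
  exists e => // n; rewrite ltnS leq_eqVlt => /predU1P[->//|nK]; exact: eK.
exists (Num.min e `|tm y K - r|) => [|n].
  by rewrite lt_min e_gt0 normr_gt0 subr_eq0.
rewrite ltnS leq_eqVlt ge_min => /predU1P[->|nK nr]; first by rewrite lexx orbT.
by rewrite eK.
Qed.

Variables (u : site -> nat -> spin) (p : trajectory R).
Hypothesis evol : evolves tm u p.

(** There is no decision time of [y] just after [r]. This will allow a spin at a random time to be
    read at a slightly later grid time. *)
Lemma evolves_right_cst (y : site) (r : R) : 0 <= r ->
  exists2 e, 0 < e & forall q, r <= q -> q < r + e -> p q y = p r y.
Proof.
move=> r_ge0; have [e e_gt0 er] := times_isolated y r; exists e => // q rq qe.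
apply: evol.2 => // n /andP[rn nq].
have := er n (elimN eqP (negbT (gt_eqF rn))).
rewrite gtr0_norm ?subr_gt0// => en.
by have := lt_le_trans qe (le_trans _ nq); rewrite -lerBrDl en ltxx => /(_ isT).
Qed.

(** Some left neighbourhood of [r], with [r] included, contains no decision time of [y], so the left
    limit is that of a constant. *)
Lemma before_evolves (y : site) (r : R) : 0 < r -> (forall n, tm y n <> r) ->
  before p r y = p r y.
Proof.
move=> r_gt0 nr; have [e e_gt0 er] := times_isolated y r.
rewrite /before; apply: (lim_near_cst (@discrete_hausdorff bool)); near=> q.
have q_ge0 : 0 <= q by near: q; exact: nbhs_left_ge.
have qr : q < r by near: q; exact: nbhs_left_lt.
have qe : r - e < q by near: q; apply: nbhs_left_gt; rewrite ltrBlDr ltrDl.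
apply/esym; apply: evol.2 => [//||n /andP[qn nr']]; first exact: ltW qr.
have := er n (nr n); rewrite ler0_norm ?subr_le0// opprB lerBrDr -lerBrDl.
by move=> /(lt_le_trans (lt_trans qe qn)); rewrite ltxx.
Unshelve. all: by end_near. Qed.

(** Only the decisions of [x] are prescribed. A neighbour never decides together with [x], so its
    spin seen just before the decision is the one that enters the reward. *)
Lemma pi_strategy_losses_finite (E : rel site) (j : site -> site -> int)
    (x : site) (c : spin) :
  finite_set [set y | E x y] -> irreflexive E ->
  u x = pi_strategy x c (tm x) (fun k => reward E j (p (tm x k)) x) p ->
  exists K, forall n, (K <= n)%N -> 0 <= reward E j (p (tm x n)) x.
Proof.
move=> Efin Eirr ux; have [N N_gt0 EN] := finite_degree_radius Efin.
pose h k := reward E j (p (tm x k)) x.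
have pE n : p (tm x n) x = decision (pi_memory x c (tm x) h p n).
  by rewrite evol.1 ux.
have nbr m n y : restr N x (before p (tm x m)) = restr N x (before p (tm x n)) ->
    E x y -> p (tm x m) y = p (tm x n) y.
  move=> eqN xy; have xNy : x != y by apply: contraTneq xy => <-; rewrite Eirr.
  have bef k : before p (tm x k) y = p (tm x k) y.
    by apply: before_evolves => // l /esym; exact: tm_neq.
  by rewrite -!bef; apply: restr_eq_in eqN _; exact: EN.
apply: (@pi_memory_losses_finite _ x c (tm x) h p N) => // m n eqN uE.
  apply: reward_same; last by rewrite !pE.
  by move=> y; exact: nbr.
apply: reward_opp => //; last by rewrite !pE.
by move=> y; exact: nbr.
Qed.

End Trajectory.

(** * Concentration of sums of independent variables *)

Section Exponential.
Context {R : realType}.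

(** The density of the exponential law of rate 1 is at most 1. *)
Lemma exponential_prob_itv_le (a b : R) : a <= b ->
  (exponential_prob 1 `[a, b]%classic <= (b - a)%:E)%E.
Proof.
move=> ab; rewrite /exponential_prob.
have -> : (b - a)%:E = (\int[lebesgue_measure]_(x in `[a, b]%classic) (cst 1%E x))%E.
  rewrite integral_cst//= mul1e lebesgue_measure_itv/= lte_fin.
  by case: ltgtP ab => //= -> _; rewrite subrr.
apply: ge0_le_integral => //.
- by move=> x _; rewrite lee_fin exponential_pdf_ge0.
- apply/measurable_EFinP/measurable_funTS; exact: measurable_exponential_pdf.
- move=> x _; rewrite /= lee_fin; have [x0|x0] := ltP x 0.
    by rewrite lt0_exponential_pdf.
  by rewrite exponential_pdfE// mul1r -[leRHS]expR0 ler_expR mulN1r oppr_le0.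
Qed.

Lemma exponential_prob_lt0 : exponential_prob 1 `]-oo, (0:R)[%classic = 0%E.
Proof.
rewrite /exponential_prob integral0_eq// => x /=; rewrite in_itv/= => x0.
by rewrite lt0_exponential_pdf.
Qed.

End Exponential.

Section Concentration.
Context {R : realType} {d : measure_display} {Omega : measurableType d}.
Variables (P : probability Omega R) (I : choiceType) (X : I -> Omega -> R).
Hypothesis mX : forall i, measurable_fun setT (X i).

Definition independent_variables : Prop :=
  forall (J : {fset I}) (A : I -> set R), (forall i, measurable (A i)) ->
    P (\bigcap_(i in [set` J]) (X i @^-1` A i)) =
    (\prod_(i <- J) P (X i @^-1` A i))%E.

Hypothesis indX : independent_variables.

Let mpre i A : measurable A -> measurable (X i @^-1` A).
Proof. by move=> mA; rewrite -[X in measurable X]setTI; exact: mX. Qed.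

Let mcap (J : {fset I}) (A : I -> set R) : (forall i, measurable (A i)) ->
  measurable (\bigcap_(i in [set` J]) (X i @^-1` A i)).
Proof.
by move=> mA; apply: fin_bigcap_measurable => // i _; exact: mpre.
Qed.

Let bigcapU1 (i : I) (J : {fset I}) (B : set R) (A : I -> set R) : i \notin J ->
  X i @^-1` B `&` \bigcap_(k in [set` J]) (X k @^-1` A k) =
  \bigcap_(k in [set` (i |` J)%fset])
    (X k @^-1` (if k == i then B else A k)).
Proof.
move=> iJ; apply/seteqP; split=> w /=.
  move=> [Bw Aw] k /=; rewrite !inE; have [->//|ki /= kJ] := eqVneq k i.
  exact: Aw.
move=> Aw; split=> [|k /= kJ].
  by have := Aw i; rewrite /= !inE eqxx; exact.
have := Aw k; rewrite /= !inE kJ orbT => /(_ isT).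
by case: eqVneq kJ iJ => // -> ->.
Qed.

(* Fixing the value of one more summand up to [delta] shifts the interval and
   enlarges it by [2 * delta]; the intersection with an event on the other
   variables makes the induction possible without product measures. *)
Lemma sum_concentration (i0 : I) (s : seq I) (e : I -> R) :
  uniq (i0 :: s) ->
  (forall a b : R, a <= b -> (P (X i0 @^-1` `[a, b]%classic) <= (b - a)%:E)%E) ->
  (forall i, `|e i| <= 1) ->
  forall (J : {fset I}) (A : I -> set R) (a b : R),
    (forall i, i \in i0 :: s -> i \notin J) -> (forall i, measurable (A i)) ->
    a <= b ->
    (P ((fun w => (X i0 w + \sum_(i <- s) e i * X i w)%R) @^-1` `[a, b]%classic
        `&` \bigcap_(i in [set` J]) (X i @^-1` A i)) <=
     (b - a)%:E * P (\bigcap_(i in [set` J]) (X i @^-1` A i)))%E.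
Proof.
move=> + X0 e1; elim: s => [|i1 s IH].
  move=> _ J A a b /(_ i0 (mem_head _ _)) i0J mA ab.
  under eq_fun do rewrite big_nil addr0.
  rewrite bigcapU1// indX; last by move=> i; case: ifP.
  rewrite big_fsetU1//= eqxx indX//.
  rewrite [X in (_ * X <= _)%E](_ : _ = \prod_(i <- J) P (X i @^-1` A i))%E.
    by apply: lee_wpmul2r; [exact: prode_ge0|exact: X0].
  rewrite big_seq [RHS]big_seq; apply: eq_bigr => i iJ.
  by case: eqVneq iJ i0J => // -> ->.
rewrite /= inE negb_or => /and3P[/andP[i01 i0s] i1s us] J A a b Jd mA ab.
set Y := fun w => (X i0 w + _)%R; set C := \bigcap_(_ in _) _.
pose Z w := (X i0 w + \sum_(i <- s) e i * X i w)%R.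
have mC : measurable C by exact: mcap.
have mY : measurable_fun setT Y.
  apply: measurable_funD => //; apply: measurable_sum => i.
  exact: measurable_funM.
have mZ : measurable_fun setT Z.
  apply: measurable_funD => //; apply: measurable_sum => i.
  exact: measurable_funM.
have mpreY (B : set R) : measurable B -> measurable (Y @^-1` B).
  by move=> mB; rewrite -[X in measurable X]setTI; exact: mY.
have mpreZ (B : set R) : measurable B -> measurable (Z @^-1` B).
  by move=> mB; rewrite -[X in measurable X]setTI; exact: mZ.
have i1J : i1 \notin J by apply: Jd; rewrite !inE eqxx orbT.
have PC1 : (P C <= 1)%E by exact: probability_le1.
apply/lee_addgt0Pr => eps eps_gt0; pose delta := eps / 2.
have delta_gt0 : 0 < delta by rewrite divr_gt0.
(* The half-open intervals of length [delta], numbered by the codes of integers; a number that codes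
   no integer gives an empty cell. *)
pose cell k := [set x : R | choice.pickle (Num.floor (x / delta)) = k].
have cellP k : measurable (cell k) /\ exists z : R,
    forall x, cell k x -> `|x - z| <= delta.
  have [[m mk]|nk] := pselect (exists m : int, choice.pickle m = k); last first.
    have -> : cell k = set0.
      by apply/seteqP; split=> // x xk; apply: nk; exists (Num.floor (x / delta)).
    by split=> //; exists 0.
  have cellE : cell k = `[m%:~R * delta, (m + 1)%:~R * delta[%classic.
    apply/seteqP; split=> x; rewrite /cell /= in_itv/= -mk.
      move=> /(pcan_inj choice.pickleK) <-.
      by rewrite -ler_pdivlMr// -ltr_pdivrMr// floor_itv.
    by rewrite -ler_pdivlMr// -ltr_pdivrMr// => /floor_def ->.
  rewrite cellE; split=> //; exists (m%:~R * delta) => x.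
  rewrite /= in_itv/= intrD mulrDl mul1r => /andP[mx xm].
  by rewrite ger0_norm ?subr_ge0// lerBlDl ltW.
have split_cells (B : set Omega) : measurable B ->
    P B = (\sum_(0 <= k <oo) P (B `&` X i1 @^-1` cell k))%E.
  move=> mB; rewrite -measure_semi_bigcup//.
  - congr (P _); apply/seteqP; split=> w; last by move=> [k _ []].
    by move=> Bw; exists (choice.pickle (Num.floor (X i1 w / delta))).
  - by move=> k; apply: measurableI => //; apply: mpre; case: (cellP k).
  - apply/trivIsetP => k l _ _ /eqP kl; rewrite -subset0.
    by move=> w [[_ /= kw] [_ /= lw]]; apply: kl; rewrite -kw.
  - apply: bigcupT_measurable => k.
    by apply: measurableI => //; apply: mpre; case: (cellP k).
rewrite (split_cells (_ `&` C)); last first.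
  by apply: measurableI => //; exact: mpreY.
(* As [P C <= 1], the excess [eps * P C] is at most [eps]. *)
apply: (@le_trans _ _ ((b - a + eps)%:E * P C)%E); last first.
  rewrite EFinD ge0_muleDl ?lee_fin ?subr_ge0// ?(ltW eps_gt0)//.
  rewrite leeD2l// -[leRHS]mule1 lee_wpmul2l// lee_fin; exact: ltW.
rewrite [X in (_ <= _ * X)%E](split_cells C)// -nneseriesZl//.
apply: lee_nneseries => // k _; have [mcell [z zP]] := cellP k.
(* The constraint on [X i1] joins those indexed by [J], so that the induction hypothesis applies to
   the remaining sum. *)
pose A' i := if i == i1 then cell k else A i.
have capE : C `&` X i1 @^-1` cell k =
    \bigcap_(i in [set` (i1 |` J)%fset]) (X i @^-1` A' i).
  by rewrite setIC bigcapU1.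
(* On the cell, [e i1 * X i1] is within [delta] of [e i1 * z], since [e i1] has absolute value at
   most 1. The interval grows by [delta] at both ends, hence [delta = eps / 2]. *)
pose a' := a - e i1 * z - delta; pose b' := b - e i1 * z + delta.
have -> : b - a + eps = b' - a' by rewrite /a' /b' /delta; field.
rewrite -setIA [in leRHS]capE.
apply: le_trans (IH _ (i1 |` J)%fset A' a' b' _ _ _); last first.
- rewrite /a' /b'; lra.
- by move=> i; rewrite /A'; case: ifP.
- move=> i is0; rewrite !inE negb_or Jd ?andbT.
    move: is0; rewrite inE => /predU1P[->//|is0].
    by apply: contraNneq i1s => <-.
  by move: is0; rewrite !inE => /orP[->//|->]; rewrite !orbT.
- by rewrite /= i0s.
apply: le_measure; rewrite ?inE -?capE.
- apply: measurableI; first exact: mpreY.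
  by apply: measurableI => //; exact: mpre.
- apply: measurableI; first exact: mpreZ.
  by apply: measurableI => //; exact: mpre.
move=> w [Yw [Cw cw]]; split=> //; have {}cw := zP _ cw.
move: Yw; rewrite /= !in_itv/= /Y big_cons -/(Z w).
have : `|e i1 * (X i1 w - z)| <= delta.
  by rewrite normrM -[leRHS]mul1r ler_pM.
rewrite /Z ler_norml /a' /b' => /andP[h1 h2] /andP[h3 h4].
by apply/andP; split; lra.
Qed.

End Concentration.

(** * Almost sure properties of the clocks *)

Section AlmostSure.
Context {R : realType} {d : measure_display} {Omega : measurableType d}.
Variable P : probability Omega R.

Lemma ae_forall_count (T : countType) (Q : T -> Omega -> Prop) :
  (forall t, {ae P, forall w, Q t w}) -> {ae P, forall w, forall t, Q t w}.
Proof.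
move=> aeQ.
have aeQ' k : {ae P, forall w,
    if choice.unpickle k is Some t then Q t w else True}.
  by case: (choice.unpickle k) => [t|]; [exact: aeQ|exact: aeW].
apply: filterS (ae_foralln aeQ') => w Qw t.
by have := Qw (choice.pickle t); rewrite choice.pickleK.
Qed.

Lemma ae_null (A : set Omega) (Q : Omega -> Prop) : measurable A -> P A = 0%E ->
  (forall w, ~ A w -> Q w) -> {ae P, forall w, Q w}.
Proof.
move=> mA PA AQ; exists A; split=> // w /= nQ.
by apply: contrapT => /AQ.
Qed.

Lemma prob_prod_le_half (T : Type) (r : seq T) (A : T -> set Omega) :
  (forall t, (P (A t) <= (2^-1)%:E)%E) ->
  (\prod_(t <- r) P (A t) <= (2^-1 ^+ size r)%:E)%E.
Proof.
move=> PA; elim: r => [|t r IH]; first by rewrite big_nil expr0.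
by rewrite big_cons /= exprS EFinM lee_pmul// prode_ge0.
Qed.

Lemma le_half_powers_eq0 (x : \bar R) : (0 <= x)%E ->
  (forall N, (x <= (2^-1 ^+ N)%:E)%E) -> x = 0%E.
Proof.
move=> x_ge0 xN; apply/eqP; rewrite eq_le x_ge0 andbT.
have xfin : x \is a fin_num by rewrite ge0_fin_numE// (le_lt_trans (xN 0%N))// ltry.
rewrite -(fineK xfin) lee_fin.
have half : `|2^-1 : R| < 1 by rewrite ger0_norm// invf_lt1// ltr1n.
rewrite -(cvg_lim (@Rhausdorff R) (cvg_expr half)).
apply: limr_ge; first by apply/cvg_ex; exists 0; exact: cvg_expr.
by apply: nearW => N; rewrite -lee_fin fineK.
Qed.

End AlmostSure.

Section Clocks.
Context {R : realType} {d : measure_display} {Omega : measurableType d}.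
Variables (P : probability Omega R) (tm : Omega -> site -> nat -> R).

Lemma sum_gaps (w : Omega) (x : site) (n : nat) :
  tm w x n = \sum_(k <- iota 0 n.+1) gap tm x k w.
Proof.
elim: n => [|n IH]; first by rewrite big_seq1 /gap subr0.
transitivity (tm w x n + gap tm x n.+1 w); first by rewrite /gap addrC subrK.
by rewrite -[n.+2]addn1 iotaD big_cat big_seq1 -IH.
Qed.

(** The times increase, and infinitely often they jump by more than one half, so they diverge. *)
Lemma gaps_gt0_times (w : Omega) (x : site) :
  (forall n, 0 < gap tm x n w) ->
  (forall k, exists n, (k <= n)%N /\ 2^-1 < gap tm x n w) ->
  (forall n, 0 < tm w x n) /\
  (forall r : R, exists K, forall n, (K <= n)%N -> r < tm w x n).
Proof.
move=> gap_gt0 gap_half.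
have tmS n : tm w x n.+1 = tm w x n + gap tm x n.+1 w.
  by rewrite /gap addrC subrK.
have tm_gt0 n : 0 < tm w x n.
  elim: n => [|n IH]; last by rewrite tmS addr_gt0.
  by have := gap_gt0 0%N; rewrite /gap subr0.
split=> // r.
have tm_mono : {homo tm w x : m n / (m <= n)%N >-> m <= n}.
  apply: homo_leq => [//|? ? ?|n]; first exact: le_trans.
  by rewrite tmS lerDl ltW.
have tm_half (m : nat) : exists K, m%:R / 2 < tm w x K.
  elim: m => [|m [K mK]]; first by exists 0%N; rewrite mul0r.
  have [[|n] [Kn n_half]]// := gap_half K.+1; exists n.+1.
  rewrite tmS -natr1 mulrDl div1r ltrD//.
  by apply: lt_le_trans mK _; exact: tm_mono.
(* Half of this integer exceeds [r]. *)
have [K mK] := tm_half (Num.truncn `|r + r|).+1; exists K => n Kn.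
apply: lt_le_trans (tm_mono _ _ Kn); apply: lt_trans mK.
rewrite ltr_pdivlMr// mulr_natr mulr2n (le_lt_trans (ler_norm _))//.
exact: truncnS_gt.
Qed.

Hypothesis poisson : poisson_times P tm.

Lemma measurable_gap (x : site) (n : nat) : measurable_fun setT (gap tm x n).
Proof.
by case: n => [|n]; apply: measurable_funB => //; exact: poisson.1.
Qed.

Let mpre (x : site) (n : nat) (A : set R) : measurable A ->
  measurable (gap tm x n @^-1` A).
Proof.
by move=> mA; rewrite -[X in measurable X]setTI; exact: measurable_gap.
Qed.

Lemma prob_gap_itv (x : site) (n : nat) (a b : R) : a <= b ->
  (P (gap tm x n @^-1` `[a, b]%classic) <= (b - a)%:E)%E.
Proof. by move=> ab; rewrite poisson.2//; exact: exponential_prob_itv_le. Qed.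

Lemma prob_gap_lt0 (x : site) (n : nat) :
  P (gap tm x n @^-1` `]-oo, 0[%classic) = 0%E.
Proof. by rewrite poisson.2//; exact: exponential_prob_lt0. Qed.

(** Negative values have probability zero, which leaves an interval of length [b]. The case [b = 0]
    serves for positivity of the gaps, [b = 2^-1] for divergence of the times. *)
Lemma prob_gap_le (x : site) (n : nat) (b : R) : 0 <= b ->
  (P (gap tm x n @^-1` `]-oo, b]%classic) <= b%:E)%E.
Proof.
move=> b_ge0.
rewrite -[leRHS]add0e -(prob_gap_lt0 x n) -[X in (_ + X%:E)%E]subr0.
apply: le_trans (leeD2l _ (prob_gap_itv x n b_ge0)).
have mi (i : interval R) : measurable (gap tm x n @^-1` [set` i]).
  by apply: mpre; exact: measurable_itv.
apply: le_trans (measureU2 _ (mi _) (mi _)).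
apply: le_measure; rewrite ?inE//; first exact: measurableU.
move=> w /=; rewrite !in_itv/= => wb.
by have [w0|w0] := ltP (gap tm x n w) 0; [left|right]; rewrite //= in_itv/= w0.
Qed.

Variables (E : Omega -> rel site) (j : Omega -> site -> site -> int)
  (X : Omega -> config) (c : Omega -> site -> spin).
Hypothesis independence : independent_sources P E j X tm c.

Lemma gaps_independent :
  independent_variables P (fun i : site * nat => gap tm i.1 i.2).
Proof.
move=> J A mA.
pose emb (i : site * nat) : source := inl (inr i).
(* The value [set0] is a default for the sources outside the image of [J]. *)
pose B (i : source) : set Omega :=
  if i is inl (inr i') then gap tm i'.1 i'.2 @^-1` A i' else set0.
have := @independence [fset emb i | i in J]%fset B _.
rewrite big_imfset/=; last by move=> ? ? _ _ [].
move=> <-.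
  congr (P _); apply/seteqP; split=> w Aw i /=; last first.
    by move=> iJ; apply: (Aw (emb i)); rewrite /= in_imfset.
  by move=> /imfsetP[/= i' i'J ->]; exact: Aw.
move=> i /imfsetP[/= [x n] _ ->]; exists (A (x, n)) => //.
by rewrite setTI.
Qed.

(** By independence, [N] successive gaps are all at most one half with probability at most
    [2^-1 ^+ N]. Hence almost surely larger gaps occur beyond every index. *)
Lemma ae_times_gt0_infty : {ae P, forall w, forall x,
  (forall n, 0 < tm w x n) /\
  (forall r : R, exists K, forall n, (K <= n)%N -> r < tm w x n)}.
Proof.
have gap_gt0 : {ae P, forall w, forall i : site * nat, 0 < gap tm i.1 i.2 w}.
  apply: ae_forall_count => -[x n].
  apply: (@ae_null _ _ _ _ (gap tm x n @^-1` `]-oo, 0]%classic)).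
  - exact: mpre.
  - by apply/eqP; rewrite eq_le measure_ge0 andbT prob_gap_le.
  - by move=> w /=; rewrite in_itv/= => /negP; rewrite -ltNge.
have gap_half : {ae P, forall w, forall i : site * nat,
    exists n, (i.2 <= n)%N /\ 2^-1 < gap tm i.1 n w}.
  apply: ae_forall_count => -[x k].
  pose A n := gap tm x n @^-1` `]-oo, 2^-1]%classic.
  have mA n : measurable (A n) by exact: mpre.
  apply: (@ae_null _ _ _ _ (\bigcap_i A (k + i)%N)).
  - exact: bigcapT_measurable.
  - apply: le_half_powers_eq0 => // N.
    pose f (i : 'I_N) := (x, (k + i)%N).
    have := gaps_independent [fset f i | i in 'I_N]%fset
      (fun=> measurable_itv `]-oo, (2^-1 : R)]).
    rewrite big_imfset/=; last by move=> a b _ _ [] /addnI /val_inj.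
    move=> PE.
    apply: (@le_trans _ _ (P (\bigcap_(i in [set` [fset f i | i in 'I_N]%fset])
        (gap tm i.1 i.2 @^-1` `]-oo, 2^-1]%classic)))).
      apply: le_measure; rewrite ?inE.
      + exact: bigcapT_measurable.
      + by apply: fin_bigcap_measurable => // i _; exact: mpre.
      + by move=> w Aw i /= /imfsetP[/= a _ ->]; exact: Aw.
    rewrite PE; apply: le_trans (prob_prod_le_half _ _) _.
      by move=> i; exact: prob_gap_le.
    by rewrite size_enum_ord.
  move=> w nA; apply: contrapT => ngap; apply: nA => i _.
  rewrite /A /= in_itv/= leNgt; apply/negP => gi; apply: ngap.
  by exists (k + i)%N; rewrite leq_addr.
apply: filterS2 gap_gt0 gap_half => w gap_gt0 gap_half x.
apply: gaps_gt0_times => [n|k]; first exact: (gap_gt0 (x, n)).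
exact: (gap_half (x, k)).
Qed.

(** The difference of two arrival times of distinct players is a signed sum of distinct gaps, and
    one gap of bounded density suffices to exclude an atom at 0. *)
Lemma ae_times_neq :
  {ae P, forall w, forall x y n m, x != y -> tm w x n <> tm w y m}.
Proof.
suff : {ae P, forall w, forall t : (site * nat) * (site * nat),
    t.1.1 != t.2.1 -> tm w t.1.1 t.1.2 <> tm w t.2.1 t.2.2}.
  by apply: filterS => w neq x y n m; exact: (neq ((x, n), (y, m))).
apply: ae_forall_count => -[[x n] [y m]] /=.
have [_|xy] := eqVneq x y; first exact: aeW.
(* The gap of index 0 of [x] stays outside [s]: it is the summand whose density bound is used. *)
pose s := [seq (x, k) | k <- iota 1 n] ++ [seq (y, k) | k <- iota 0 m.+1].
pose e (i : site * nat) : R := if i.1 == x then 1 else -1.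
pose D w := gap tm x 0 w + \sum_(i <- s) e i * gap tm i.1 i.2 w.
have DE w : D w = tm w x n - tm w y m.
  have sx : \sum_(i <- [seq (x, k) | k <- iota 1 n]) e i * gap tm i.1 i.2 w =
      tm w x n - gap tm x 0 w.
    rewrite big_map sum_gaps big_cons addrAC subrr add0r.
    by apply: eq_bigr => k _; rewrite /e eqxx mul1r.
  have sy : \sum_(i <- [seq (y, k) | k <- iota 0 m.+1]) e i * gap tm i.1 i.2 w =
      - tm w y m.
    rewrite big_map sum_gaps -sumrN.
    by apply: eq_bigr => k _; rewrite /e eq_sym (negbTE xy) mulN1r.
  by rewrite /D /s big_cat sx sy/= addrA [_ + (_ - _)]addrC subrK.
have us : uniq ((x, 0%N) :: s).
  have pair_inj (z : site) : injective (fun k : nat => (z, k)) by move=> ? ? [].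
  rewrite cons_uniq mem_cat negb_or cat_uniq !(map_inj_uniq (pair_inj _)).
  rewrite !iota_uniq andTb andbT -andbA; apply/and3P; split.
  - by apply/mapP => -[k]; rewrite mem_iota => + [k0]; rewrite -k0.
  - by apply/mapP => -[k _ [/eqP]]; rewrite (negbTE xy).
  - apply/hasPn => i /mapP[k _ ->]; apply/mapP => -[k' _ [/eqP]].
    by rewrite eq_sym (negbTE xy).
have mD : measurable_fun setT D.
  apply: measurable_funD; first exact: measurable_gap.
  apply: measurable_sum => i; apply: measurable_funM => //.
  exact: measurable_gap.
apply: (@ae_null _ _ _ _ (D @^-1` `[0, 0]%classic)).
- by rewrite -[X in measurable X]setTI; exact: mD.
(* With [J] empty and the interval reduced to the point 0, the concentration bound is 0. *)
- have := @sum_concentration _ _ _ P _ _ (fun i => measurable_gap i.1 i.2)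
    gaps_independent (x, 0%N) s e us (prob_gap_itv x 0) _ fset0 (fun=> setT) 0 0.
  rewrite subrr mul0e => /(_ _ _ _ (lexx 0)) PD.
  apply/eqP; rewrite eq_le measure_ge0 andbT; apply: le_trans (PD _ _ _) => //.
  + by rewrite set_fset0 bigcap_set0 setIT.
  + by move=> i; rewrite /e; case: ifP; rewrite ?normrN normr1.
- by move=> w nD _ eqt; apply: nD; rewrite /= in_itv/= DE eqt subrr lexx.
Qed.

End Clocks.

(** * The last losing time *)

Lemma uniform_rank (T : eqType) (s : seq T) (Q : nat -> T -> Prop) :
  (forall t, t \in s -> exists K, forall k, (K <= k)%N -> Q k t) ->
  exists K, forall k, (K <= k)%N -> forall t, t \in s -> Q k t.
Proof.
elim: s => [|t s IH] Qs; first by exists 0%N.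
have [|K1 QK1] := IH; first by move=> u us; apply: Qs; rewrite inE us orbT.
have [K2 QK2] := Qs t (mem_head _ _).
exists (maxn K1 K2) => k; rewrite geq_max => /andP[K1k K2k] u.
by rewrite inE => /predU1P[->|us]; [exact: QK2|exact: QK1].
Qed.

Section MeasurableLosses.
Context {R : realType} {d : measure_display} {Omega : measurableType d}.

(** Preimages are countable unions of level sets. Real values give access to the measurability of
    sums and products. *)
Lemma measurable_intr (f : Omega -> int) :
  (forall m, measurable [set w | f w = m]) ->
  measurable_fun setT (fun w => (f w)%:~R : R).
Proof.
move=> mf _ B mB; rewrite setTI.
have -> : (fun w => (f w)%:~R : R) @^-1` B =
    \bigcup_k (if choice.unpickle k is Some m then
                 if `[< B m%:~R >] then [set w | f w = m] else set0
               else set0).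
  apply/seteqP; split=> w /=.
    move=> Bf; exists (choice.pickle (f w)) => //=.
    by rewrite choice.pickleK asboolT.
  by move=> [k _]; case: choice.unpickle => // m; case: asboolP => // Bm /= ->.
apply: bigcupT_measurable => k; case: choice.unpickle => // m.
by case: ifP.
Qed.

Variables (E : Omega -> rel site) (j : Omega -> site -> site -> int)
  (tm : Omega -> site -> nat -> R) (sigma : Omega -> trajectory R).
Hypothesis mj : forall x y (k : int), measurable [set w | j w x y = k].
Hypothesis mtm : forall x n, measurable_fun setT (fun w => tm w x n).
Hypothesis msigma : forall (r : R) (x : site), 0 <= r ->
  measurable [set w | sigma w r x].

(* The spin of [y] at the first multiple of [1 / k.+1] after [tm w x n], which
   is measurable in [w] although [sigma w (tm w x n) y] need not be. *)
Definition late_spin (x : site) (n k : nat) (y : site) : set Omega :=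
  [set w | exists i : nat, i%:R <= tm w x n * k.+1%:R < i.+1%:R /\
    sigma w (i.+1%:R / k.+1%:R) y].

Definition late_config (x : site) (n k : nat) (w : Omega) : config :=
  fun y => `[< late_spin x n k y w >].

(** The same index [k] refines the time grid and enlarges the set of sites, which eventually
    contains any finite neighbourhood. *)
Definition late_sum (x : site) (n k : nat) (w : Omega) : int :=
  \sum_(y <- ball_sites k x) j w x y * spin_val (late_config x n k w x) *
    spin_val (late_config x n k w y).

(** A measurable substitute for the event of losing; [lossP] identifies the two on regular paths. *)
Definition loss (x : site) (n : nat) : set Omega :=
  [set w | exists K, forall k, (K <= k)%N -> late_sum x n k w < 0].

Lemma measurable_late_spin x n k y : measurable (late_spin x n k y).
Proof.
have -> : late_spin x n k y =
    \bigcup_i ((fun w => tm w x n * k.+1%:R) @^-1` `[i%:R, i.+1%:R[%classic `&`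
               [set w | sigma w (i.+1%:R / k.+1%:R) y]).
  apply/seteqP; split=> w; first by move=> [i [ti si]]; exists i; rewrite //= in_itv.
  by move=> [i _ [/=]]; rewrite in_itv/= => ti si; exists i.
apply: bigcupT_measurable => i; apply: measurableI; last exact/msigma/divr_ge0.
rewrite -[X in measurable X]setTI.
by apply: (measurable_funM (mtm x n) (measurable_cst _)).
Qed.

Lemma measurable_late_sum x n k :
  measurable_fun setT (fun w => (late_sum x n k w)%:~R : R).
Proof.
have mspin y : measurable_fun setT
    (fun w => (spin_val (late_config x n k w y))%:~R : R).
  apply: measurable_intr => m; pose A := late_spin x n k y.
  have -> : [set w | spin_val (late_config x n k w y) = m] =
      (A `&` [set _ | 1 = m]) `|` (~` A `&` [set _ | -1 = m]).
    apply/seteqP; split=> w /=; rewrite /late_config -/A.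
      by case: asboolP => Aw /= wm; [left|right].
    by case: asboolP => Aw /= [] [].
  have mA : measurable A by exact: measurable_late_spin.
  have mprop (Q : Prop) : measurable [set _ : Omega | Q].
    have [q|nq] := pselect Q; first by rewrite (propT q); exact: measurableT.
    by rewrite (propF nq); exact: measurable0.
  by apply: measurableU; apply: measurableI => //; exact: measurableC.
under eq_fun do rewrite /late_sum rmorph_sum/=.
apply: measurable_sum => y; under eq_fun do rewrite !intrM.
by apply: measurable_funM => //; apply: measurable_funM => //; exact: measurable_intr.
Qed.

Lemma measurable_loss x n : measurable (loss x n).
Proof.
have -> : loss x n = \bigcup_K \bigcap_(k in [set k | (K <= k)%N])
    (fun w => (late_sum x n k w)%:~R : R) @^-1` `]-oo, 0[%classic.
  apply/seteqP; split=> w.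
    move=> [K wK]; exists K => // k /= Kk.
    by rewrite in_itv/= ltrz0 wK.
  move=> [K _ wK]; exists K => k Kk.
  by have := wK k Kk; rewrite /= in_itv/= ltrz0.
apply: bigcupT_measurable => K; apply: bigcap_measurableType => k _.
by rewrite -[X in measurable X]setTI; exact: measurable_late_sum.
Qed.

(** Each late spin is exact for large [k]. Although the list of sites grows with [k], only finitely
    many spins have to settle, because [j] gives weight 0 to sites that are not neighbours. *)
Lemma lossP (w : Omega) (u : site -> nat -> spin) (x : site) (n : nat) :
  (forall y n, 0 < tm w y n) ->
  (forall y (r : R), exists K, forall n, (K <= n)%N -> r < tm w y n) ->
  evolves (tm w) u (sigma w) -> finite_set [set y | E w x y] ->
  (forall y, ~~ E w x y -> j w x y = 0) ->
  loss x n w <-> reward (E w) (j w) (sigma w (tm w x n)) x < 0.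
Proof.
move=> t_gt0 t_infty evol Efin j0.
have [N N_gt0 EN] := finite_degree_radius Efin.
set t := tm w x n.
have late_eq y : exists K, forall k, (K <= k)%N ->
    late_config x n k w y = sigma w t y.
  have [e e_gt0 te] := evolves_right_cst t_infty evol y (ltW (t_gt0 x n)).
  (* For such [k] the mesh is less than [e], so the sampled grid time falls where the spin of [y] is
     still constant. *)
  exists (Num.truncn e^-1) => k ek.
  have ke : k.+1%:R^-1 < e.
    rewrite invf_plt ?posrE// (lt_le_trans (truncnS_gt _))//.
    by rewrite ler_nat.
  have late i : i%:R <= t * k.+1%:R < i.+1%:R ->
      sigma w (i.+1%:R / k.+1%:R) y = sigma w t y.
    rewrite -ler_pdivrMr// -ltr_pdivlMr// => /andP[it ti].
    apply: te; first exact: ltW.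
    by rewrite -natr1 mulrDl div1r ler_ltD.
  rewrite /late_config; case: asboolP => [[i [ti <-]]|]; first by rewrite -(late i).
  move=> nlate; apply/esym/negbTE/negP => st; apply: nlate.
  have ti :
      (Num.truncn (t * k.+1%:R))%:R <= t * k.+1%:R < (Num.truncn (t * k.+1%:R)).+1%:R.
    by apply: truncn_itv; rewrite mulr_ge0// ltW// t_gt0.
  by exists (Num.truncn (t * k.+1%:R)); rewrite late.
have [|K lateK] := @uniform_rank _ (x :: ball_sites N x)
  (fun k y => late_config x n k w y = sigma w t y); first by move=> y _.
have sumE k : (maxn N K <= k)%N ->
    reward (E w) (j w) (sigma w t) x = Num.sg (late_sum x n k w).
  rewrite geq_max => /andP[Nk Kk]; rewrite (@reward_ball _ _ _ k)//; last first.
    by move=> y /EN yN; exact: leq_trans yN Nk.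
  congr Num.sg; apply: eq_bigr => y _.
  have [/EN yN|/j0 ->] := boolP (E w x y); last by rewrite !mul0r.
  by rewrite !(lateK k Kk)// inE ?eqxx// mem_ball_sites ?orbT.
split=> [[K' wK']|loses].
  by rewrite (sumE (maxn (maxn N K) K')) ?leq_maxl// sgr_lt0 wK'// leq_maxr.
by exists (maxn N K) => k Kk; rewrite -sgr_lt0 -sumE.
Qed.

Variable M : nat.

(** Decisions without loss, players outside the box and numbers that code no decision contribute 0.
    The maximum keeps the value nonnegative for every [w], not just almost surely. *)
Definition losing_time (k : nat) (w : Omega) : \bar R :=
  if choice.unpickle k is Some (x, n) then
    if `[< box M x >] then (Num.max 0 (tm w x n * \1_(loss x n) w))%:E else 0%E
  else 0%E.

Definition last_losing_time (w : Omega) : \bar R := esups (losing_time ^~ w) 0.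

Lemma measurable_last_losing_time : measurable_fun setT last_losing_time.
Proof.
apply: measurable_fun_esups => k; rewrite /losing_time.
case: choice.unpickle => [[x n]|]; last exact: measurable_cst.
case: asboolP => _; last exact: measurable_cst.
apply/measurable_EFinP; apply: measurable_maxr; first exact: measurable_cst.
apply: measurable_funM; first exact: mtm.
by apply: measurable_indic; exact: measurable_loss.
Qed.

Lemma le_last_losing_time k w : (losing_time k w <= last_losing_time w)%E.
Proof. by apply: ereal_sup_ubound; exists k. Qed.

Lemma last_losing_time_ge0 w : (0 <= last_losing_time w)%E.
Proof.
apply: le_trans (le_last_losing_time 0 w); rewrite /losing_time.
case: choice.unpickle => [[x n]|]//; case: ifP => // _.
by rewrite lee_fin le_max lexx.
Qed.

Lemma last_losing_time_fin w :
  (forall x, box M x -> exists K, forall n, (K <= n)%N -> ~ loss x n w) ->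
  (last_losing_time w < +oo)%E.
Proof.
move=> fin_loss.
(* Sites of the box are within distance [M + M] of the origin. *)
have [|K wK] := @uniform_rank _ (ball_sites (M + M) (0, 0))
    (fun k x => box M x -> forall n, tm w x n * \1_(loss x n) w <= k%:R).
  move=> x _; have [/fin_loss[K wK]|] := pselect (box M x); last by exists 0%N.
  (* The sum dominates every time of index less than [K], and from [K] on there is no loss. *)
  exists (Num.truncn (\sum_(i < K) `|tm w x i|)).+1 => k Kk _ n.
  have [nK|Kn] := ltnP n K; last first.
    by rewrite indicE memNset ?mulr0//; exact: wK.
  apply: (@le_trans _ _ `|tm w x n|).
    by rewrite indicE; case: (_ \in _); rewrite ?mulr1 ?mulr0 ?ler_norm.
  apply: (@le_trans _ _ (\sum_(i < K) `|tm w x i|)).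
    by rewrite (bigD1 (Ordinal nK))//= lerDl sumr_ge0.
  by rewrite (le_trans (ltW (truncnS_gt _)))// ler_nat.
apply: (@le_lt_trans _ _ K%:R%:E); last exact: ltry.
apply: ge_ereal_sup => _ [k _ <-]; rewrite /losing_time.
case: choice.unpickle => [[x n]|]; last by rewrite lee_fin.
case: asboolP => [Mx|_]; last by rewrite lee_fin.
rewrite lee_fin ge_max ler0n; apply: wK => //.
by apply: mem_ball_sites; case: x Mx => x1 x2; rewrite /dist /box /=; lia.
Qed.

End MeasurableLosses.

Theorem proposition1 (R : realType) (d : measure_display)
  (Omega : measurableType d) (P : probability Omega R)
  (E : Omega -> rel site) (j : Omega -> site -> site -> int)
  (tm : Omega -> site -> nat -> R) (c : Omega -> site -> spin)
  (sigma : Omega -> trajectory R) (s : Omega -> site -> strategy R) (M : nat)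
  (graphE : random_graph P E) (couplingsj : couplings E j)
  (poisson : poisson_times P tm) (coins : fair_coins P c)
  (initial : symmetric_bernoulli P (fun w => sigma w 0))
  (independence :
     independent_sources P E j (fun w => sigma w 0) tm c)
  (sigma_measurable :
     forall (r : R) (x : site), 0 <= r -> measurable [set w | sigma w r x])
  (s_nonanticipating :
     forall w x, ~ box M x -> nonanticipating (s w x))
  (s_pi : forall w x, box M x -> s w x = pi_strategy (R := R) x (c w x))
  (sigma_evolves :
     {ae P, forall w, evolves (tm w)
       (decisions (E w) (j w) (tm w) (s w) (sigma w)) (sigma w)}) :
  exists T_M : Omega -> \bar R,
    [/\ measurable_fun setT T_M,
        (forall w, (0 <= T_M w)%E),
        {ae P, forall w, (T_M w < +oo)%E} &
        {ae P, forall w, forall x, box M x ->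
          forall sigma' : trajectory R,
            deviation (E w) (j w) (tm w) (s w) (sigma w) x (T_M w) sigma' ->
            ~ exists n : nat,
                [/\ (T_M w < (tm w x n)%:E)%E,
                    0 <= reward (E w) (j w) (sigma' (tm w x n)) x &
                    reward (E w) (j w) (sigma w (tm w x n)) x < 0]}].
Proof.
case: graphE => _ Esym _ Efin; case: couplingsj => mj j0 _.
have mtm := poisson.1.
exists (last_losing_time j tm sigma M).
have ae_fin : {ae P, forall w, forall x, finite_set [set y | E w x y]}.
  exact: (@ae_forall_count _ _ _ P site).
have ae_times := ae_times_gt0_infty poisson independence.
have ae_neq := ae_times_neq poisson independence.
(* On one almost sure event, [loss] is genuine losing and each player of the box loses finitely
   often. *)
have ae_losses : {ae P, forall w,
    (forall x n, loss j tm sigma x n w <->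
       reward (E w) (j w) (sigma w (tm w x n)) x < 0) /\
    (forall x, box M x -> exists K, forall n, (K <= n)%N ->
       0 <= reward (E w) (j w) (sigma w (tm w x n)) x)}.
  apply: filterS2 (filterI ae_fin sigma_evolves) (filterI ae_times ae_neq).
  move=> w [fin evol] [times neq].
  have t_gt0 y : forall n, 0 < tm w y n by exact: (times y).1.
  have t_infty y := (times y).2.
  split=> [x n|x Mx].
    by apply: lossP t_gt0 t_infty evol (fin x) _ => y; exact: j0.
  apply: (@pi_strategy_losses_finite _ _ t_gt0 t_infty neq _ _ evol (E w) (j w) x
    (c w x)) => //; first exact: (Esym w).2.
  by rewrite /decisions s_pi.
split.
- exact: measurable_last_losing_time.
- exact: last_losing_time_ge0.
- apply: filterS ae_losses => w [lossE fin]; apply: last_losing_time_fin => x Mx.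
  have [K wK] := fin x Mx; exists K => n Kn /lossE.
  by rewrite ltNge wK.
- apply: filterS ae_losses => w [lossE _] x Mx sigma' _ [n [late _ /lossE lose]].
  (* A loss puts its own time below the supremum, which contradicts [late], whatever the
     deviation. *)
  have := le_last_losing_time j tm sigma M (choice.pickle (x, n)) w.
  rewrite /losing_time choice.pickleK asboolT// indicE mem_set// mulr1.
  by move=> /le_lt_trans/(_ late); rewrite lte_fin gt_max ltxx andbF.
Qed.
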